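(* Let $n\ge 1$ and let $H_1$ and $H_2$ be two Hopf fibrations of $S^{2n-1}$. Suppose one of the following holds: (1) $H_1$ and $H_2$ have opposite sign and $n$ is even; (2) $H_1$ and $H_2$ have the same sign and $n$ is odd. Then $H_1$ and $H_2$ share an oriented fiber, i.e. there is an oriented great circle of $S^{2n-1}$ which is a fiber, with the same orientation, of both $H_1$ and $H_2$.
   Context: View $S^{2n-1}$ as the unit sphere in $\mathbb{R}^{2n}\cong\mathbb{C}^n$ (with $\mathbb{C}^n \cong \mathbb{R}^{2n}$ via $(x_1+iy_1,\dots,x_n+iy_n)\mapsto (x_1,y_1,\dots,x_n,y_n)$), and $S^1$ as the complex unit circle oriented counterclockwise. $S^1$ acts on $S^{2n-1}$ by scalar multiplication. The standard Hopf fibration $H$ of $S^{2n-1}$ is the fibration whose fibers are the orbits of this action, which are oriented great circles. A Hopf fibration of $S^{2n-1}$ is a fibration of the form $T(H)$ (the fibers are the images under $T$ of the fibers of $H$, with the transported orientations), where $T:\mathbb{R}^{2n}\to\mathbb{R}^{2n}$ is an orthogonal linear transformation. It has positive sign if $\det(T)>0$ and negative sign if $\det(T)<0$. *)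

(* Defs.v *)
From mathcomp Require Import all_boot all_order all_algebra.
From mathcomp Require Import complex.
From mathcomp Require Import all_classical reals.

Set Implicit Arguments.
Unset Strict Implicit.
Unset Printing Implicit Defensive.

Import Order.TTheory GRing.Theory Num.Theory.

Local Open Scope classical_set_scope.
Local Open Scope ring_scope.
Local Open Scope complex_scope.

Section HopfFibrations.
Variable R : realType.

(* The Euclidean inner product; the library's norm on 'rV is the sup norm. *)
Definition dot m (u v : 'rV[R]_m) : R := \sum_i u 0 i * v 0 i.

Definition unit_sphere m : set 'rV[R]_m := [set x | dot x x = 1].

(* The identification of C^n with R^(2n),
     (x_1 + i y_1, ..., x_n + i y_n) |-> (x_1, y_1, ..., x_n, y_n):
   mxvec lists the entries of an n x 2 matrix row by row. *)
Definition realify n (z : 'rV[R[i]]_n) : 'rV[R]_(n * 2) :=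
  mxvec (\matrix_(j < n, k < 2)
           (if k == 0 then complex.Re (z 0 j) else complex.Im (z 0 j))).

Definition unit_circle : set R[i] := [set c | `|c| = 1].

(* An oriented smooth curve, represented by the set of all pairs (p, t) with p
   a point of the curve and t the unit tangent vector at p that points in the
   direction of the orientation. Two such sets are equal exactly when the
   curves have the same points and the same orientation. *)
Definition oriented_curve m := set ('rV[R]_m * 'rV[R]_m).

(* For c = cos a + i sin a, the pair consists of the point
   (cos a) u + (sin a) v and of the derivative in a of that expression. *)
Definition great_circle m (u v : 'rV[R]_m) : oriented_curve m :=
  [set (complex.Re c *: u + complex.Im c *: v,
        - complex.Im c *: u + complex.Re c *: v) | c in unit_circle].

Definition is_oriented_great_circle m (F : oriented_curve m) : Prop :=
  exists u v : 'rV[R]_m,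
    [/\ dot u u = 1, dot v v = 1, dot u v = 0 & F = great_circle u v].

(* The orbit of z under S^1, oriented by the counterclockwise orientation of
   S^1: the counterclockwise unit tangent vector of S^1 at c is i c, and the
   orbit map c |-> c z sends it to the tangent vector i c z at c z. *)
Definition orbit_curve n (z : 'rV[R[i]]_n) : oriented_curve (n * 2) :=
  [set (realify (c *: z), realify (('i * c) *: z)) | c in unit_circle].

(* A fibration of the sphere by oriented curves is the set of its fibers. *)
Definition standard_hopf n : set (oriented_curve (n * 2)) :=
  [set orbit_curve z | z in [set z | unit_sphere (realify z)]].
Arguments standard_hopf : clear implicits.

(* A linear map x |-> x *m T is its own differential, so it carries the
   oriented tangent vectors by the same formula as the points. *)
Definition image_curve m (T : 'M[R]_m) (F : oriented_curve m) :
  oriented_curve m := [set (pt.1 *m T, pt.2 *m T) | pt in F].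

Definition image_fibration m (T : 'M[R]_m) (H : set (oriented_curve m)) :
  set (oriented_curve m) := [set image_curve T F | F in H].

Definition orthogonal_mx m (T : 'M[R]_m) : Prop := T *m T^T = 1%:M.

Definition is_hopf n (H : set (oriented_curve (n * 2))) : Prop :=
  exists T : 'M[R]_(n * 2),
    orthogonal_mx T /\ H = image_fibration T (standard_hopf n).

Definition positive_hopf n (H : set (oriented_curve (n * 2))) : Prop :=
  exists T : 'M[R]_(n * 2),
    [/\ orthogonal_mx T, H = image_fibration T (standard_hopf n) & 0 < \det T].

Definition negative_hopf n (H : set (oriented_curve (n * 2))) : Prop :=
  exists T : 'M[R]_(n * 2),
    [/\ orthogonal_mx T, H = image_fibration T (standard_hopf n) & \det T < 0].

Definition same_sign n (H1 H2 : set (oriented_curve (n * 2))) : Prop :=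
  (positive_hopf H1 /\ positive_hopf H2) \/
  (negative_hopf H1 /\ negative_hopf H2).

Definition opposite_sign n (H1 H2 : set (oriented_curve (n * 2))) : Prop :=
  (positive_hopf H1 /\ negative_hopf H2) \/
  (negative_hopf H1 /\ positive_hopf H2).

End HopfFibrations.

Arguments standard_hopf : clear implicits.

(* Main.v *)
Require Import Defs.
From mathcomp Require Import all_boot all_order all_algebra.
From mathcomp Require Import complex.
From mathcomp Require Import all_classical reals.

(* Write J for multiplication by i and J_k = T_k^-1 J T_k for the complex
   structure whose fibration is T_k(H). The fiber of T_k(H) through p is the
   great circle from p towards J_k p, so a common oriented fiber is a kernel
   vector of S = J_1 - J_2. If the skew matrix S is invertible, then det S > 0.
   Moreover J_1 S = - S J_2, so S conjugates J_1 into - J_2, while complex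
   conjugation K conjugates - J into J. Hence T_1 S T_2^-1 K commutes with J:
   it is complex linear and has determinant > 0. As det K = (-1)^n, the
   product det T_1 * det T_2 * (-1)^n is positive, which the sign hypothesis
   excludes. *)

Set Implicit Arguments.
Unset Strict Implicit.
Unset Printing Implicit Defensive.

Import Order.TTheory GRing.Theory Num.Theory.

Local Open Scope classical_set_scope.
Local Open Scope ring_scope.
Local Open Scope complex_scope.

(** * Square matrices whose two sizes are equal but not convertible *)

Section Matrices.
Variables (F : comUnitRingType) (m m' : nat) (eq_mm' : m = m').
Variables (P : 'M[F]_(m, m')) (Q : 'M[F]_(m', m)).
Hypothesis PQ1 : P *m Q = 1%:M.

(** Needed because [n + n] and [n * 2] are only provably equal: eliminating [eq_mm'] makes [P] and
    [Q] square. *)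
Lemma mulmx1C_cast : Q *m P = 1%:M.
Proof. by case: _ / eq_mm' P Q PQ1 => ? ? /mulmx1C. Qed.

Lemma det_conj_cast (D : 'M_m) : \det (Q *m D *m P) = \det D.
Proof.
case: _ / eq_mm' P Q PQ1 => P' Q' PQ1'.
by rewrite !det_mulmx mulrAC -det_mulmx (mulmx1C PQ1') det1 mul1r.
Qed.

End Matrices.

(** * Sign of the determinant: skew matrices and complex linear maps *)

Section RealMatrices.
Variable R : realType.

Lemma dotE m (u v : 'rV[R]_m) : dot u v = (u *m v^T) 0 0.
Proof. by rewrite mxE; apply: eq_bigr => i _; rewrite mxE. Qed.

Lemma dot_ge0 m (u : 'rV[R]_m) : 0 <= dot u u.
Proof. by apply: sumr_ge0 => i _; rewrite -expr2 sqr_ge0. Qed.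

Lemma dot_eq0 m (u : 'rV[R]_m) : (dot u u == 0) = (u == 0).
Proof.
apply/idP/eqP => [|->]; last by rewrite dotE mul0mx mxE.
rewrite psumr_eq0 => [/allP u0|i _]; last by rewrite -expr2 sqr_ge0.
apply/rowP => i; rewrite mxE; apply/eqP.
by have := u0 i (mem_index_enum _); rewrite mulf_eq0 orbb.
Qed.

Lemma dot_unit_scale m (u : 'rV[R]_m) : u != 0 ->
  exists a : R, dot (a *: u) (a *: u) = 1.
Proof.
rewrite -dot_eq0 => u0; exists (Num.sqrt (dot u u))^-1.
rewrite dotE linearZ /= -scalemxAl -scalemxAr scalerA [LHS]mxE -dotE.
rewrite -expr2 exprVn.
by rewrite sqr_sqrtr ?dot_ge0 // mulVf.
Qed.

Lemma dot_skew m (S : 'M[R]_m) (u : 'rV_m) : S^T = - S -> dot u (u *m S) = 0.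
Proof.
move=> Sskew; have trE (M : 'M[R]_1) : M 0 0 = M^T 0 0 by rewrite mxE.
have: dot u (u *m S) = - dot u (u *m S).
  rewrite !dotE [LHS]trE !trmx_mul !trmxK Sskew.
  by rewrite mulNmx mulmxN mulmxA [in RHS]mxE opprK.
by move/eqP; rewrite -addr_eq0 -mulr2n mulrn_eq0 => /eqP.
Qed.

(** If [\det S < 0], the polynomial det(X + S) is negative at 0, hence has a root x >= 0. An
    eigenvector v of [- S] for x satisfies x (v.v) = 0 by skewness, so x = 0 and [\det S = 0], a
    contradiction. *)
Lemma det_skew_ge0 m (S : 'M[R]_m) : S^T = - S -> 0 <= \det S.
Proof.
move=> Sskew; set p := char_poly (- S).
have p0 : p.[0] = \det S.
  by rewrite horner_coef0 char_poly_det -detZ scaleN1r opprK.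
have [b pb] := monic_Cauchy_bound (char_poly_monic (- S)).
rewrite leNgt; apply/negP => detS_lt0.
(* Beyond the Cauchy bound [b] the monic [p] is positive; the maximum keeps the right endpoint
   nonnegative. *)
have [||x /andP[x_ge0 _]] := @poly_ivt _ p 0 (Num.max 0 b).
- by rewrite le_max lexx.
- by rewrite p0 ltW //= ltW // pb // le_max lexx orbT.
rewrite -eigenvalue_root_char => /[dup] xeig /eigenvalueP[v vS v0].
have : x * dot v v = 0.
  have := @dot_skew _ (- S) v; rewrite linearN /= Sskew vS => /(_ erefl).
  by rewrite !dotE linearZ /= -scalemxAr [LHS]mxE.
move/eqP; rewrite mulf_eq0 dot_eq0 (negPf v0) orbF => /eqP x0.
by move: xeig; rewrite eigenvalue_root_char x0 /root -/p p0 lt_eqF.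
Qed.

(** Over [R[i]] the block matrix is similar, through [L] and its inverse [U], to a block triangular
    one with diagonal blocks A + iB and its conjugate, so its determinant is |det(A + iB)|^2. *)
Lemma det_complex_block_ge0 n (A B : 'M[R]_n) :
  0 <= \det (block_mx A B (- B) A).
Proof.
pose f := real_complex R; pose Ac := map_mx f A; pose Bc := map_mx f B.
pose L : 'M[R[i]]_(n + n) := block_mx 1%:M 0 (- 'i)%:M 1%:M.
pose U : 'M[R[i]]_(n + n) := block_mx 1%:M 0 'i%:M 1%:M.
have LMU : L *m map_mx f (block_mx A B (- B) A) *m U =
    block_mx (Ac + 'i *: Bc) Bc 0 (Ac - 'i *: Bc).
  rewrite map_block_mx map_mxN -/Ac -/Bc !mulmx_block.
  rewrite !mul1mx !mul0mx !mulmx1 !mulmx0 !addr0 !add0r.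
  rewrite !mul_scalar_mx !mul_mx_scalar !scaleNr [_ + Ac]addrC.
  congr block_mx; rewrite scalerBr scalerA -expr2 sqr_i scaleN1r opprK.
  by rewrite -opprD addNr.
have conjE : Ac - 'i *: Bc = map_mx conjc (Ac + 'i *: Bc).
  apply/matrixP => i j; by rewrite !mxE; simpc.
have := congr1 determinant LMU.
rewrite !det_mulmx !det_lblock !det1 !mulr1 mul1r det_ublock conjE det_map_mx.
rewrite det_map_mx /= -sqr_normc => detE.
by rewrite -lecR [X in _ <= X]detE exprn_ge0.
Qed.

End RealMatrices.

(** * The complex structure in real coordinates, and the fibers as great circles *)

Section HopfFibers.
Variables (R : realType) (n : nat).

(* The rows of [axes 0] and [axes 1] are the real, respectively imaginary,
   coordinate vectors of C^n under the identification [realify]. *)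
Definition axes (k : 'I_2) : 'M[R]_(n, n * 2) :=
  \matrix_(i < n) mxvec (delta_mx i k).

Lemma axesE k i j l : axes k i (mxvec_index j l) = ((j == i) && (l == k))%:R.
Proof. by rewrite mxE mxvecE mxE. Qed.

Lemma axes_tr k l : axes k *m (axes l)^T = (k == l)%:R%:M.
Proof.
apply/matrixP => i j; rewrite mxE (bigD1 (mxvec_index j l)) //= big1 => [|a].
  rewrite addr0 axesE [_^T _ _]mxE axesE !eqxx mulr1 mxE [j == i]eq_sym.
  by rewrite [l == k]eq_sym; case: (k == l) (i == j) => [] [].
case/mxvec_indexP: a => i' l' neq.
rewrite mulrC [_^T _ _]mxE axesE.
case: eqP => [ei|_]; last by rewrite mul0r.
by case: eqP => [el|_]; [rewrite ei el eqxx in neq | rewrite mul0r].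
Qed.

(** Change of coordinates from (x_1, ..., x_n, y_1, ..., y_n) to the interleaved (x_1, y_1, ...,
    x_n, y_n), for row vectors. *)
Definition axes_mx : 'M[R]_(n + n, n * 2) := col_mx (axes 0) (axes 1).

Lemma axes_mx_tr : axes_mx *m axes_mx^T = 1%:M.
Proof.
by rewrite tr_col_mx mul_col_row !axes_tr /= !raddf0 [RHS]scalar_mx_block.
Qed.

Lemma dim_eq : (n + n = n * 2)%N. Proof. by rewrite muln2 addnn. Qed.

Lemma axes_complete :
  (axes 0)^T *m axes 0 + (axes 1)^T *m axes 1 = 1%:M.
Proof.
by rewrite -mul_row_col -tr_col_mx (mulmx1C_cast dim_eq axes_mx_tr).
Qed.

(** Multiplication by ['i], acting on row vectors from the right. *)
Definition Jmx : 'M[R]_(n * 2) := (axes 0)^T *m axes 1 - (axes 1)^T *m axes 0.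

(** Complex conjugation. *)
Definition Kmx : 'M[R]_(n * 2) := (axes 0)^T *m axes 0 - (axes 1)^T *m axes 1.

Lemma axes0_J : axes 0 *m Jmx = axes 1.
Proof.
by rewrite mulmxBr !mulmxA !axes_tr /= mul1mx raddf0 mul0mx subr0.
Qed.

Lemma axes1_J : axes 1 *m Jmx = - axes 0.
Proof.
by rewrite mulmxBr !mulmxA !axes_tr /= mul1mx raddf0 mul0mx sub0r.
Qed.

Lemma axes0_K : axes 0 *m Kmx = axes 0.
Proof.
by rewrite mulmxBr !mulmxA !axes_tr /= mul1mx raddf0 mul0mx subr0.
Qed.

Lemma axes1_K : axes 1 *m Kmx = - axes 1.
Proof.
by rewrite mulmxBr !mulmxA !axes_tr /= mul1mx raddf0 mul0mx sub0r.
Qed.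

Lemma tr_Jmx : Jmx^T = - Jmx.
Proof. by rewrite linearB /= !trmx_mul !trmxK opprB. Qed.

Lemma Jmx_sqr : Jmx *m Jmx = - 1%:M.
Proof.
rewrite {1}/Jmx mulmxBl -!mulmxA axes0_J axes1_J mulmxN -opprD.
by rewrite axes_complete.
Qed.

Lemma mulKJ : Kmx *m Jmx = - (Jmx *m Kmx).
Proof.
rewrite [in LHS]/Kmx [in RHS]/Jmx !mulmxBl -!mulmxA.
by rewrite axes0_J axes1_J axes0_K axes1_K !mulmxN opprB !opprK addrC.
Qed.

Lemma det_Kmx : \det Kmx = (-1) ^+ n.
Proof.
have -> : Kmx = axes_mx^T *m block_mx 1%:M 0 0 (- 1%:M) *m axes_mx.
  rewrite tr_col_mx mul_row_block mul_row_col !mulmx0 addr0 add0r mulmx1.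
  by rewrite mulmxN mulmx1 mulNmx.
rewrite (det_conj_cast dim_eq axes_mx_tr) det_lblock det1 mul1r.
by rewrite -scaleN1r detZ det1 mulr1.
Qed.

(** In block coordinates, commuting with [Jmx] forces the shape treated in
    [det_complex_block_ge0]. *)
Lemma det_commJ_ge0 (U : 'M[R]_(n * 2)) :
  U *m Jmx = Jmx *m U -> 0 <= \det U.
Proof.
move=> UJ; pose A := axes 0 *m U *m (axes 0)^T.
pose B := axes 0 *m U *m (axes 1)^T.
have blockE : axes_mx *m U *m axes_mx^T = block_mx A B (- B) A.
  (* The lower blocks come from the upper ones: write [axes 1] as [axes 0 *m Jmx], move [Jmx] past
     [U], and absorb it into the transposed axes, using that [Jmx] is skew. *)
  rewrite tr_col_mx mul_col_mx mul_col_row -/A -/B -[in axes 1 *m U]axes0_J.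
  rewrite -(mulmxA _ Jmx) -UJ !mulmxA -!(mulmxA _ Jmx).
  rewrite -(trmxK Jmx) -!trmx_mul tr_Jmx !mulmxN axes0_J axes1_J opprK.
  by rewrite linearN mulmxN.
have -> : U = axes_mx^T *m (axes_mx *m U *m axes_mx^T) *m axes_mx.
  rewrite !mulmxA (mulmx1C_cast dim_eq axes_mx_tr) mul1mx -mulmxA.
  by rewrite (mulmx1C_cast dim_eq axes_mx_tr) mulmx1.
by rewrite (det_conj_cast dim_eq axes_mx_tr) blockE det_complex_block_ge0.
Qed.

Lemma realifyE (z : 'rV[R[i]]_n) :
  realify z = map_mx (@complex.Re R) z *m axes 0
            + map_mx (@complex.Im R) z *m axes 1.
Proof.
have mulE (u : 'rV[R]_n) k j l :
    (u *m axes k) 0 (mxvec_index j l) = u 0 j * (l == k)%:R.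
  rewrite mxE (bigD1 j) //= axesE eqxx /= big1 ?addr0 // => i /negPf ij.
  by rewrite axesE eq_sym ij mulr0.
apply/rowP => a; case/mxvec_indexP: a => j k; rewrite mxvecE mxE.
rewrite [RHS]mxE !mulE !mxE.
case: k => [[|[|//]]] lt_k2; rewrite -!val_eqE /= mulr1 mulr0.
  by rewrite addr0.
by rewrite add0r.
Qed.

Lemma realify_surj (x : 'rV[R]_(n * 2)) : exists z, realify z = x.
Proof.
exists (\row_j (x 0 (mxvec_index j 0) +i* x 0 (mxvec_index j 1))).
apply/rowP => a; case/mxvec_indexP: a => j k; rewrite mxvecE !mxE /=.
case: k => [[|[|//]]] lt_k2 /=; congr (x 0 (mxvec_index j _));
  exact: val_inj.
Qed.

Lemma realifyZ (c : R[i]) (z : 'rV_n) : realify (c *: z) =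
  complex.Re c *: realify z + complex.Im c *: (realify z *m Jmx).
Proof.
set a := complex.Re c; set b := complex.Im c.
pose x := map_mx (@complex.Re R) z; pose y := map_mx (@complex.Im R) z.
have ReZ : map_mx (@complex.Re R) (c *: z) = a *: x - b *: y.
  by apply/rowP => j; rewrite !mxE /a /b; case: (c) (z 0 j) => ? ? [].
have ImZ : map_mx (@complex.Im R) (c *: z) = a *: y + b *: x.
  by apply/rowP => j; rewrite !mxE /a /b; case: (c) (z 0 j) => ? ? [].
rewrite !realifyE ReZ ImZ -/x -/y !mulmxDl -!(mulmxA _ _ Jmx) axes0_J axes1_J.
rewrite mulNmx mulmxN -!scalemxAl addrACA [- _ + _]addrC -scalerDr.
by rewrite scalerBr.
Qed.

Definition hopf_structure (T : 'M[R]_(n * 2)) := T^T *m Jmx *m T.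

Lemma image_hopf_fiber (T : 'M[R]_(n * 2)) (p : 'rV_(n * 2)) :
    orthogonal_mx T -> dot p p = 1 ->
  image_fibration T (standard_hopf R n)
    (great_circle p (p *m hopf_structure T)).
Proof.
(* The orbit to transport is that of the preimage of [p], as [T^T] inverts [T]. *)
move=> Torth p1; have [z zE] := realify_surj (p *m T^T).
have TT : T^T *m T = 1%:M by apply: mulmx1C.
exists (orbit_curve z).
  exists z => //; rewrite /unit_sphere /= zE dotE trmx_mul trmxK mulmxA.
  by rewrite -(mulmxA p) TT mulmx1 -dotE.
have zT : realify z *m T = p by rewrite zE -mulmxA TT mulmx1.
have zJT : realify z *m Jmx *m T = p *m hopf_structure T by rewrite zE !mulmxA.
rewrite /image_curve /orbit_curve /great_circle image_comp.
apply: eq_imagel => c _ /=; congr pair.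
  by rewrite realifyZ mulmxDl -!scalemxAl zT zJT.
(* Tangent vectors agree because Re(ic) = - Im c and Im(ic) = Re c. *)
rewrite realifyZ mulmxDl -!scalemxAl zT zJT.
by rewrite mulrC ReiNIm ImiRe.
Qed.

End HopfFibers.

(** * Comparing the complex structures of two Hopf fibrations *)

Lemma hopf_structure_skew (R : realType) n (T : 'M[R]_(n * 2)) :
  (hopf_structure T)^T = - hopf_structure T.
Proof. by rewrite !trmx_mul trmxK tr_Jmx mulNmx mulmxN mulmxA. Qed.

Lemma hopf_structure_sqr (R : realType) n (T : 'M[R]_(n * 2)) :
  orthogonal_mx T -> hopf_structure T *m hopf_structure T = - 1%:M.
Proof.
move=> Torth; rewrite /hopf_structure !mulmxA -(mulmxA _ T) Torth mulmx1.
rewrite -(mulmxA _ (Jmx R n) (Jmx R n)) Jmx_sqr mulmxN mulmx1 mulNmx.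
by rewrite (mulmx1C Torth).
Qed.

Lemma hopf_structure_intertwine (R : realType) n (T : 'M[R]_(n * 2)) :
  orthogonal_mx T -> T *m hopf_structure T = Jmx R n *m T.
Proof. by move=> Torth; rewrite !mulmxA Torth mul1mx. Qed.

Lemma mulmx_hopf_tr (R : realType) n (T : 'M[R]_(n * 2)) :
  orthogonal_mx T -> hopf_structure T *m T^T = T^T *m Jmx R n.
Proof. by move=> Torth; rewrite -mulmxA Torth mulmx1. Qed.

Lemma det_sub_hopf_structure (R : realType) n (T1 T2 : 'M[R]_(n * 2)) :
    orthogonal_mx T1 -> orthogonal_mx T2 ->
    \det (hopf_structure T1 - hopf_structure T2) != 0 ->
  0 <= \det T1 * \det T2 * (-1) ^+ n.
Proof.
move=> o1 o2; set J1 := hopf_structure T1; set J2 := hopf_structure T2.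
set S := J1 - J2 => detS0.
have detS_gt0 : 0 < \det S.
  rewrite lt_def detS0 det_skew_ge0 //.
  by rewrite linearB /= !hopf_structure_skew -opprD.
(* Both sides equal - 1 - J1 J2, since J1 and J2 square to - 1. *)
have J1S : J1 *m S = - (S *m J2).
  by rewrite mulmxBr mulmxBl !hopf_structure_sqr // opprB.
(* Moving J through [S] and through [Kmx] changes the sign twice, so the product commutes with J. *)
have: 0 <= \det (T1 *m S *m T2^T *m Kmx R n).
  apply: det_commJ_ge0.
  rewrite -mulmxA mulKJ mulmxN !mulmxA -(mulmxA _ _ (Jmx R n)).
  rewrite -(mulmx_hopf_tr o2) -(hopf_structure_intertwine o1) -/J1 -/J2.
  rewrite -(mulmxA T1 J1) J1S.
  by rewrite !mulmxN !mulNmx !mulmxA.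
rewrite !det_mulmx det_tr det_Kmx mulrAC -!mulrA mulrCA.
by rewrite pmulr_rge0 // [_ * \det T2]mulrC.
Qed.

Lemma hopf_fibrations_share_fiber (R : realType) n (T1 T2 : 'M[R]_(n * 2)) :
    orthogonal_mx T1 -> orthogonal_mx T2 ->
    \det T1 * \det T2 * (-1) ^+ n < 0 ->
  exists F : oriented_curve R (n * 2),
    [/\ is_oriented_great_circle F,
        image_fibration T1 (standard_hopf R n) F &
        image_fibration T2 (standard_hopf R n) F].
Proof.
move=> o1 o2 detT; have : \det (hopf_structure T1 - hopf_structure T2) == 0.
  by apply: contraTT detT => /det_sub_hopf_structure; rewrite -leNgt; apply.
case/det0P => v v0 /eqP; rewrite mulmxBr subr_eq0 => /eqP vJ.
(* Normalizing the kernel vector puts it on the sphere; both fibers through [p] then have the same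
   initial tangent vector. *)
have [a p1] := dot_unit_scale v0; set p := a *: v in p1.
have pJ : p *m hopf_structure T1 = p *m hopf_structure T2.
  by rewrite -!scalemxAl vJ.
exists (great_circle p (p *m hopf_structure T1)); split.
- exists p, (p *m hopf_structure T1); split => //.
    rewrite dotE trmx_mul hopf_structure_skew mulNmx mulmxN mulmxA -(mulmxA p).
    by rewrite hopf_structure_sqr // mulmxN mulmx1 mulNmx opprK -dotE.
  exact/dot_skew/hopf_structure_skew.
- exact: image_hopf_fiber.
- by rewrite pJ; apply: image_hopf_fiber.
Qed.

Theorem theorem1p4 (R : realType) (n : nat) (hn : (1 <= n)%N)
    (H1 H2 : set (oriented_curve R (n * 2)))
    (hopf1 : is_hopf H1) (hopf2 : is_hopf H2)
    (hsign : (opposite_sign H1 H2 /\ ~~ odd n) \/ (same_sign H1 H2 /\ odd n)) :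
  exists F : oriented_curve R (n * 2),
    [/\ is_oriented_great_circle F, H1 F & H2 F].
Proof.
case: hsign => [] [[]] [[T1 [o1 -> d1]] [T2 [o2 -> d2]]] n_odd;
  apply: hopf_fibrations_share_fiber => //; rewrite -signr_odd.
- by rewrite (negPf n_odd) expr0 mulr1 pmulr_rlt0.
- by rewrite (negPf n_odd) expr0 mulr1 nmulr_rlt0.
- by rewrite n_odd expr1 mulrN1 oppr_lt0 mulr_gt0.
- by rewrite n_odd expr1 mulrN1 oppr_lt0 nmulr_rgt0.
Qed.
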